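(* Let $\mathbb{A}\colon\mathbb{R}^d\to\mathbb{R}^d$ be Lipschitz continuous and monotone, let $T>0$ and $X_0\in\mathbb{R}^d$. Then the system (Dual-Anchor ODE) \[ \dot X(t)=-Z(t)-\mathbb{A}(X(t)),\qquad \dot Z(t)=-\frac{1}{T-t}Z(t)-\frac{1}{T-t}\mathbb{A}(X(t)),\qquad t\in(0,T), \] with $X(0)=X_0$, $Z(0)=0$, has a unique solution $X\colon[0,T)\to\mathbb{R}^d$ (together with $Z$), the limit $X(T)=\lim_{t\to T^-}X(t)$ exists, and for every $X_\star\in\mathrm{Zer}\,\mathbb{A}$, \[ \|\mathbb{A}(X(T))\|^2\le\frac{4\|X_0-X_\star\|^2}{T^2}. \]
   Context: $\mathbb{A}$ is monotone if $\langle\mathbb{A}x-\mathbb{A}y,x-y\rangle\ge0$ for all $x,y$. $\mathrm{Zer}\,\mathbb{A}=\{x:\mathbb{A}x=0\}$. *)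

(* Defs.v *)
From HB Require Import structures.
From mathcomp Require Import all_boot all_order all_algebra.
From mathcomp Require Import all_classical all_reals all_analysis.
Set Implicit Arguments. Unset Strict Implicit. Unset Printing Implicit Defensive.
Import Order.TTheory GRing.Theory Num.Theory.
Import numFieldNormedType.Exports.
Local Open Scope classical_set_scope.
Local Open Scope ring_scope.

Definition dotv (R : realType) (d : nat) (u v : 'rV[R]_d) : R :=
  \sum_(i < d) u ord0 i * v ord0 i.
Definition enorm (R : realType) (d : nat) (u : 'rV[R]_d) : R :=
  Num.sqrt (dotv u u).

Definition lipschitz_op (R : realType) (d : nat) (A : 'rV[R]_d -> 'rV[R]_d) : Prop :=
  exists L : R, forall x y, enorm (A x - A y) <= L * enorm (x - y).

Definition monotone_op (R : realType) (d : nat) (A : 'rV[R]_d -> 'rV[R]_d) : Prop :=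
  forall x y, 0 <= dotv (A x - A y) (x - y).

Definition dual_anchor_sol (R : realType) (d : nat) (A : 'rV[R]_d -> 'rV[R]_d)
  (T : R) (X0 : 'rV[R]_d) (X Z : R -> 'rV[R]_d) : Prop :=
  [/\ X 0 = X0, Z 0 = 0,
      X t @[t --> 0^'+] --> X0,
      Z t @[t --> 0^'+] --> (0 : 'rV[R]_d) &
      forall t : R, 0 < t < T ->
        [/\ derivable X t 1, derivable Z t 1,
            derive1 X t = - Z t - A (X t) &
            derive1 Z t = - ((T - t)^-1 *: Z t) - (T - t)^-1 *: A (X t)]].

(* Main.v *)
(* With a = A X the system reads X' = - (Z + a), Z' = - (Z + a) / (T - t). It is
   linear in (X, Z, a), so the difference of two solutions satisfies it again,
   and (p, - A p) is a stationary solution for every p. Let (x, z, a) be such a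
   difference.
   - If |a| <= L |x|, then |x|^2 + (T - t) |z|^2 grows at most exponentially:
     this gives uniqueness and, against a stationary solution, bounds X up to T.
   - The derivative of |z|^2 / (T - t) is at most |a|^2 / (T - t)^2. Hence Z and
     X' are bounded, so X converges to some XT at a linear rate; against
     (XT, - A XT), where now a = O(T - t), the same inequality gives z -> 0.
   - The derivative of <z, x> / (T - t) - |z|^2 / 2 is - <a, x> / (T - t)^2,
     which is nonpositive when A is monotone. Against (XT, - A XT) this function
     tends to 0 at T, so its initial value <A XT, X0 - XT> / T - |A XT|^2 / 2 is
     nonnegative. Adding <A XT, XT - Xs> >= 0 yields the bound.
   Solutions exist because, on every [0, b] with b < T, the Picard iteration
   contracts in a sup norm with exponential weight. *)

Require Import Defs.
From HB Require Import structures.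
From mathcomp Require Import all_boot all_order all_algebra.
From mathcomp Require Import all_classical all_reals all_analysis.
From mathcomp Require Import ring lra.
Import Order.TTheory GRing.Theory Num.Theory.
Import numFieldNormedType.Exports.
Set Implicit Arguments.
Unset Strict Implicit.
Unset Printing Implicit Defensive.
Local Open Scope classical_set_scope.
Local Open Scope ring_scope.

(* The library has matrices both complete and normed, but not the join. *)
HB.instance Definition _ (R : realType) (m n : nat) :=
  Complete.copy 'M[R]_(m, n) 'M[R]_(m, n).

Section row_vectors.
Context {R : realType} {n : nat}.
Implicit Types u : 'rV[R]_n.

Lemma ler_coord_norm u i : `|u ord0 i| <= `|u|.
Proof.
rewrite [leRHS]/Num.Def.normr/= mx_normrE.
exact: (le_bigmax _ (fun ij => `|u ij.1 ij.2|) (ord0, i)).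
Qed.

Lemma ler_rV_norm u (c : R) :
  0 <= c -> (forall i, `|u ord0 i| <= c) -> `|u| <= c.
Proof.
move=> c0 uc; rewrite [leLHS]/Num.Def.normr/= mx_normrE.
by apply: bigmax_le => // -[i j] _ /=; rewrite ord1.
Qed.

Lemma is_derive_rVP (u : R -> 'rV[R]_n) (t : R) (du : 'rV[R]_n) :
  is_derive t 1 u du <->
  forall i, is_derive t 1 (fun s => u s ord0 i) (du ord0 i).
Proof.
split=> [[ud <-] i|u'].
  split; first by move/derivable_mxP : ud; exact.
  by rewrite derive_mx// mxE.
have ud : derivable u t 1.
  by apply/derivable_mxP => i j; rewrite ord1; case: (u' j).
by split=> //; rewrite derive_mx//; apply/rowP => i; rewrite mxE; case: (u' i).
Qed.

Lemma cvg_rVP {T : Type} (F : set_system T) {FF : Filter F}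
    (u : T -> 'rV[R]_n) (l : 'rV[R]_n) :
  u x @[x --> F] --> l <-> forall i, u x ord0 i @[x --> F] --> l ord0 i.
Proof.
split=> [ul i|ul].
  exact: (continuous_cvg _ (@coord_continuous R 1 n ord0 i l) ul).
apply/cvgrPdist_le => e e0; near=> x.
apply: ler_rV_norm (ltW e0) _ => i; rewrite !mxE.
move: i; near: x; apply: filter_forall => i.
by move/cvgrPdist_le : (ul i); apply.
Unshelve. all: by end_near. Qed.

End row_vectors.

Section column_selection.
Context {R : realType} {m n : nat}.
Implicit Types (f : 'I_m -> 'I_n).

Lemma norm_colsub_le f (u : 'rV[R]_n) : `|colsub f u| <= `|u|.
Proof. by apply: ler_rV_norm => // i; rewrite mxE ler_coord_norm. Qed.

Lemma cvg_colsub f {T : Type} (F : set_system T) {FF : Filter F}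
    (u : T -> 'rV[R]_n) (l : 'rV[R]_n) :
  u x @[x --> F] --> l -> colsub f (u x) @[x --> F] --> colsub f l.
Proof.
move=> /cvg_rVP ul; apply/cvg_rVP => i; rewrite mxE.
by under eq_fun do rewrite mxE; exact: ul.
Qed.

Lemma is_derive_colsub f (u : R -> 'rV[R]_n) (t : R) (du : 'rV[R]_n) :
  is_derive t 1 u du -> is_derive t 1 (colsub f \o u) (colsub f du).
Proof.
move=> /is_derive_rVP u'; apply/is_derive_rVP => i; rewrite mxE.
rewrite (_ : (fun s => _) = (fun s => u s ord0 (f i)))//.
by apply/funext => s; rewrite mxE.
Qed.

End column_selection.

Section row_blocks.
Context {R : realType} {m n : nat}.

Lemma norm_row_mx_le (u : 'rV[R]_m) (v : 'rV[R]_n) (c : R) :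
  `|u| <= c -> `|v| <= c -> `|row_mx u v| <= c.
Proof.
move=> uc vc; apply: ler_rV_norm => [|i]; first exact: le_trans uc.
rewrite mxE; case: (fintype.split i) => j.
  exact: le_trans (ler_coord_norm _ _) uc.
exact: le_trans (ler_coord_norm _ _) vc.
Qed.

Lemma cvg_row_mx {T : Type} (F : set_system T) {FF : Filter F}
    (u : T -> 'rV[R]_m) (v : T -> 'rV[R]_n)
    (lu : 'rV[R]_m) (lv : 'rV[R]_n) :
  u x @[x --> F] --> lu -> v x @[x --> F] --> lv ->
  row_mx (u x) (v x) @[x --> F] --> row_mx lu lv.
Proof.
move=> /cvg_rVP ul /cvg_rVP vl; apply/cvg_rVP => i; rewrite mxE.
by under eq_fun do rewrite mxE; case: (fintype.split i).
Qed.

End row_blocks.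

Section mean_value.
Context {R : realType}.
Implicit Types (f g df dg : R -> R) (a b c x : R).

Lemma is_derive_continuous (V : normedModType R) (f : R -> V) x l :
  is_derive x 1 f l -> {for x, continuous f}.
Proof. by move=> [fx _]; apply/differentiable_continuous/derivable1_diffP. Qed.

Lemma is_derive_within (V : normedModType R) (f df : R -> V) a b :
  (forall x, a <= x <= b -> is_derive x 1 f (df x)) ->
  {within `[a, b], continuous f}.
Proof.
move=> f'; apply: continuous_in_subspaceT => x; rewrite inE/= in_itv/= => xab.
exact: is_derive_continuous (f' x xab).
Qed.

Lemma is_derive_mull c x : is_derive x 1 (fun y : R => c * y) c.
Proof.
apply: (is_derive_eq (is_deriveZ c (is_derive_id x (1 : R)))).
by rewrite /GRing.scale/= mulr1.
Qed.

Lemma is_derive_expRM c x :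
  is_derive x 1 (fun y => expR (c * y)) (c * expR (c * x)).
Proof.
rewrite mulrC; apply: (@is_derive1_comp _ expR (fun y => c * y)).
exact: is_derive_mull.
Qed.

Lemma ler_is_derive f g df dg a b : a <= b ->
  {within `[a, b], continuous f} -> {within `[a, b], continuous g} ->
  (forall x, a < x < b -> is_derive x 1 f (df x)) ->
  (forall x, a < x < b -> is_derive x 1 g (dg x)) ->
  (forall x, a < x < b -> df x <= dg x) ->
  f b - f a <= g b - g a.
Proof.
rewrite le_eqVlt => /predU1P[->|ab] cf cg f' g' le_dfg; first by rewrite !subrr.
have [||x] := @MVT R (g - f) (fun x => dg x - df x) a b ab.
- move=> x; rewrite in_itv/= => xab.
  by apply: is_deriveB; [exact: g'|exact: f'].
- exact: within_continuousB.
rewrite in_itv/= => xab gfE.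
have : 0 <= (g - f) b - (g - f) a.
  by rewrite gfE mulr_ge0 ?subr_ge0 ?(ltW ab)// le_dfg.
by rewrite !fctE; lra.
Qed.

Lemma ler_norm_is_derive n (f df : R -> 'rV[R]_n) g dg a b : a <= b ->
  {within `[a, b], continuous f} -> {within `[a, b], continuous g} ->
  (forall x, a < x < b -> is_derive x 1 f (df x)) ->
  (forall x, a < x < b -> is_derive x 1 g (dg x)) ->
  (forall x, a < x < b -> `|df x| <= dg x) ->
  `|f b - f a| <= g b - g a.
Proof.
move=> ab cf cg f' g' le_dfg; apply: ler_rV_norm => [|i].
  rewrite -(subrr (0 : R)).
  apply: (@ler_is_derive (cst 0) g (cst 0) dg) => // [x|x xab].
    exact: cvg_cst.
  exact: le_trans (normr_ge0 _) (le_dfg x xab).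
pose fi x := f x ord0 i.
have cfi : {within `[a, b], continuous fi}.
  move=> x; apply: (@continuous_comp (subspace `[a, b]) _ _ f
    (fun u : 'rV[R]_n => u ord0 i)); first exact: cf.
  exact: coord_continuous.
have fi' x : a < x < b -> is_derive x 1 fi (df x ord0 i).
  by move=> /f'/is_derive_rVP; exact.
have dfi x : a < x < b -> - dg x <= df x ord0 i <= dg x.
  by move=> /le_dfg; rewrite -ler_norml; exact: le_trans (ler_coord_norm _ _).
rewrite !mxE -!/(fi _) ler_norml; apply/andP; split; last first.
  by apply: (ler_is_derive ab cfi cg fi' g') => x /dfi/andP[].
rewrite lerNl.
have := @ler_is_derive (- fi) g (fun x => - df x ord0 i) dg a b ab.
rewrite !fctE opprB opprK addrC; apply=> //.
- by move=> x; apply: continuousN; exact: cfi.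
- by move=> x xab; apply: is_deriveN; exact: fi'.
- by move=> x /dfi/andP[dfix _]; rewrite lerNl.
Qed.

End mean_value.

Lemma lipschitz_continuous {R : realType} (V W : normedModType R) (f : V -> W)
    (K : R) : 0 <= K ->
  (forall x y, `|f x - f y| <= K * `|x - y|) -> continuous f.
Proof.
move=> K0 fK x; have K1 : 0 < K + 1 by rewrite ltr_wpDl.
apply/cvgrPdist_le => e e0; near=> y.
apply: (@le_trans _ _ ((K + 1) * `|x - y|)).
  by rewrite (le_trans (fK x y))// ler_wpM2r// lerDl.
rewrite -ler_pdivlMl// mulrC ltW//; near: y.
by apply/nbhs_normP; exists (e / (K + 1)) => //=; rewrite divr_gt0.
Unshelve. all: by end_near. Qed.

Section geometric_convergence.
Context {R : realType}.

Lemma cvg_divr_exp2 (c : R) : c / 2 ^+ k @[k --> \oo] --> 0.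
Proof.
rewrite (_ : (fun k => _) = geometric c 2^-1).
  by apply: cvg_geometric; rewrite gtr0_norm ?invf_lt1// ltr1n.
by apply/funext => k; rewrite /= exprVn.
Qed.

Lemma le0_divr_exp2 (x c : R) : (forall k, x <= c / 2 ^+ k) -> x <= 0.
Proof.
by move=> xc; apply: (cvgr_to_ge (cvg_divr_exp2 c)); exact: nearW.
Qed.

Lemma geometric_dist_lim (V : completeNormedModType R) (u : nat -> V) (c : R) :
  (forall k, `|u k.+1 - u k| <= c / 2 ^+ k) ->
  forall k, `|u k - limn u| <= 2 * c / 2 ^+ k.
Proof.
move=> uc.
have c0 : 0 <= c by have := le_trans (normr_ge0 _) (uc 0); rewrite expr0 divr1.
have tail m k : `|u (k + m)%N - u k| <= 2 * c / 2 ^+ k - 2 * c / 2 ^+ (k + m).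
  elim: m => [|m IH]; first by rewrite addn0 !subrr normr0.
  rewrite addnS (le_trans (ler_distD (u (k + m)%N) _ _))//.
  have -> : 2 * c / 2 ^+ k - 2 * c / 2 ^+ (k + m).+1 =
      c / 2 ^+ (k + m) + (2 * c / 2 ^+ k - 2 * c / 2 ^+ (k + m)).
    by rewrite exprS; field; rewrite !expf_neq0.
  exact: lerD (uc _) IH.
have {}tail m k : (k <= m)%N -> `|u m - u k| <= 2 * c / 2 ^+ k.
  move=> /subnKC <-; apply: le_trans (tail _ _) _.
  by rewrite gerBl divr_ge0 ?mulr_ge0 ?exprn_ge0.
have cu : cvgn u.
  apply/cauchy_cvgP/cauchy_exP => e e0.
  have /cvgrPdist_lt/(_ _ e0) [k _ /(_ k (leqnn k))] := cvg_divr_exp2 (2 * c).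
  rewrite sub0r normrN => /ltr_normlW cke.
  exists (u k); exists k => // m km /=; rewrite -ball_normE/= distrC.
  exact: le_lt_trans (tail _ _ km) cke.
move=> k; have dist : `|u k - u m| @[m --> \oo] --> `|u k - limn u|.
  by apply: cvg_norm; apply: cvgB => //; exact: cvg_cst.
apply: (cvgr_to_le dist); exists k => // m km.
by rewrite /= distrC; exact: tail.
Qed.

Lemma continuous_geometric_limit (U : topologicalType) (V : normedModType R)
    (f_ : nat -> U -> V) (f : U -> V) (c : R) (x : U) :
  (forall k, {for x, continuous (f_ k)}) ->
  (\forall y \near x, forall k, `|f_ k y - f y| <= c / 2 ^+ k) ->
  {for x, continuous f}.
Proof.
move=> cf_ dist; apply/cvgrPdist_lt => e e0.
have e3 : 0 < e / 3 by rewrite divr_gt0.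
have /cvgrPdist_lt/(_ _ e3)[k _ /(_ k (leqnn k))] := cvg_divr_exp2 c.
rewrite sub0r normrN => /ltr_normlW cke.
have distk y : (forall k, `|f_ k y - f y| <= c / 2 ^+ k) ->
    `|f_ k y - f y| < e / 3.
  by move=> /(_ k) fky; exact: le_lt_trans fky cke.
near=> y.
have fkxy : `|f_ k x - f_ k y| < e / 3.
  by near: y; have /cvgrPdist_lt := cf_ k; exact.
have fky : `|f_ k y - f y| < e / 3 by apply: distk; near: y.
have fkx : `|f_ k x - f x| < e / 3.
  by apply: distk; exact: nbhs_singleton dist.
rewrite (le_lt_trans (ler_distD (f_ k x) _ _))// [`|f x - _|]distrC.
rewrite (le_lt_trans (lerD (lexx _) (ler_distD (f_ k y) _ _)))//.
by rewrite (_ : e = e / 3 + (e / 3 + e / 3)) ?ltrD//; field.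
Unshelve. all: by end_near. Qed.

End geometric_convergence.

Section left_limits.
Context {R : realType}.
Implicit Types (a b c e x y : R).

Lemma ler0_is_derive_le (f df : R -> R) a b :
  f x @[x --> a^'+] --> f a ->
  (forall x, a < x < b -> is_derive x 1 f (df x)) ->
  (forall x, a < x < b -> df x <= 0) ->
  forall x, a <= x < b -> f x <= f a.
Proof.
move=> fa f' df0 y /andP[]; rewrite le_eqVlt => /predU1P[->//|ay yb].
have ayb x : a < x <= y -> a < x < b.
  by move=> /andP[-> /le_lt_trans]; exact.
have cf : {within `[a, y], continuous f}.
  have cfx x : a < x <= y -> {for x, continuous f}.
    by move=> /ayb/f'; exact: is_derive_continuous.
  apply/(continuous_within_itvP _ ay); split=> //.
    by move=> x; rewrite in_itv/= => /andP[ax /ltW xy]; apply: cfx; rewrite ax.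
  by apply: cvg_at_left_filter; apply: cfx; rewrite ay lexx.
have ayb' x : a < x < y -> a < x < b.
  by move=> /andP[ax /ltW xy]; apply: ayb; rewrite ax.
rewrite -subr_le0 -[leRHS](subrr (0 : R)).
apply: (@ler_is_derive _ f (cst 0) df (cst 0) _ _ (ltW ay) cf) => //.
- by move=> x; exact: cvg_cst.
- by move=> x /ayb'; exact: f'.
- by move=> x /ayb'; exact: df0.
Qed.

Lemma gronwall_le (f df : R -> R) a b c :
  f x @[x --> a^'+] --> f a ->
  (forall x, a < x < b -> is_derive x 1 f (df x)) ->
  (forall x, a < x < b -> df x <= c * f x) ->
  forall x, a <= x < b -> f x <= f a * expR (c * (x - a)).
Proof.
move=> fa f' dfc y ayb.
pose g x := expR (- c * x) * f x.
suff : g y <= g a.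
  rewrite /g !mulNr !expRN mulrC ler_pdivrMr ?expR_gt0//.
  by rewrite mulrBr expRB mulrCA [f a * _]mulrC mulrA [_ * expR _]mulrC mulrA.
have e' x := is_derive_expRM (- c) x.
apply: (@ler0_is_derive_le g
    (fun x => expR (- c * x) * (df x - c * f x)) a b _ _ _ y ayb).
- apply: cvgM => //; apply: cvg_at_right_filter.
  exact: is_derive_continuous (e' a).
- move=> x /f' fx; apply: is_derive_eq (is_deriveM (e' x) fx) _.
  by rewrite /GRing.scale/=; ring.
- by move=> x axb; rewrite pmulr_rle0 ?expR_gt0// subr_le0 dfc.
Qed.

Lemma is_derive_subV a x : x < a ->
  is_derive x 1 (fun y => (a - y)^-1) ((a - x)^-1 ^+ 2).
Proof.
move=> xa; have ax : a - x != 0 by rewrite lt0r_neq0// subr_gt0.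
apply: is_derive_eq (@is_deriveV _ (cst a - id) x _ 1 ax
  (is_deriveB (is_derive_cst _ _ _) (is_derive_id _ _))) _.
by rewrite sub0r /GRing.scale/= mulrNN mulr1 exprVn.
Qed.

Lemma near_left_mulB_lt a c e : 0 < e -> \forall x \near a^'-, c * (a - x) < e.
Proof.
move=> e0; have : c * (a - x) @[x --> a^'-] --> c * (a - a).
  apply: cvg_at_left_filter; apply: cvgM; first exact: cvg_cst.
  by apply: cvgB; [exact: cvg_cst|exact: cvg_id].
by rewrite subrr mulr0 => /cvgr_lt; exact.
Qed.

Lemma cvg_at_left_bounded_derive n (f df : R -> 'rV[R]_n) a b c : a < b ->
  (forall x, a < x < b -> is_derive x 1 f (df x)) ->
  (forall x, a < x < b -> `|df x| <= c) ->
  exists2 l, f x @[x --> b^'-] --> l &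
    forall x, a < x < b -> `|f x - l| <= c * (b - x).
Proof.
move=> ab f' dfc.
have c0 : 0 <= c.
  have mid : a < (a + b) / 2 < b by apply/andP; split; lra.
  exact: le_trans (normr_ge0 _) (dfc _ mid).
have f_dist x y : a < x -> x <= y -> y < b -> `|f x - f y| <= c * (b - x).
  move=> ax xy yb; apply: (@le_trans _ _ (c * (y - x))); last first.
    by rewrite ler_wpM2l// lerB// ltW.
  have xyab z : x <= z <= y -> a < z < b.
    by move=> /andP[xz zy]; rewrite (lt_le_trans ax)//= (le_lt_trans zy).
  have xyab' z : x < z < y -> a < z < b.
    by move=> /andP[xz zy]; apply: xyab; rewrite !ltW.
  rewrite distrC mulrBr.
  apply: (ler_norm_is_derive (g := fun z => c * z) (dg := cst c) xy).
  - by apply: is_derive_within => z /xyab; exact: f'.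
  - by apply: (is_derive_within (df := cst c)) => z _; exact: is_derive_mull.
  - by move=> z /xyab'; exact: f'.
  - by move=> z _; exact: is_derive_mull.
  - by move=> z /xyab'; exact: dfc.
have /cvg_ex[l fl] : cvg (f x @[x --> b^'-]).
  apply/cauchy_cvgP/cauchy_exP => e e0; near b^'- => x; exists (f x).
  have xb : x < b by near: x; exact: nbhs_left_lt.
  rewrite /= -ball_normE; near=> y => /=.
  apply: (@le_lt_trans _ _ (c * (b - x))).
    apply: f_dist; first by near: x; exact: nbhs_left_gt.
      by near: y; exact: nbhs_left_ge.
    by near: y; exact: nbhs_left_lt.
  by near: x; exact: near_left_mulB_lt.
exists l => // x /andP[ax xb].
have dist : `|f x - f y| @[y --> b^'-] --> `|f x - l|.
  by apply: cvg_norm; apply: cvgB => //; exact: cvg_cst.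
apply: (cvgr_to_le dist); near=> y; apply: f_dist => //.
by near: y; exact: nbhs_left_ge.
Unshelve. all: by end_near. Qed.

End left_limits.

Section primitive.
Context {R : realType} {n : nat}.
Implicit Types (f : R -> 'rV[R]_n) (t T : R).

Definition primitive f t : 'rV[R]_n :=
  \row_i parameterized_integral lebesgue_measure 0 t (fun s => f s ord0 i).

Lemma primitive_le0 f t : t <= 0 -> primitive f t = 0.
Proof.
move=> t0; apply/rowP => i; rewrite !mxE /parameterized_integral.
move: t0; rewrite le_eqVlt => /predU1P[->|t0].
  by rewrite set_itv1 Rintegral_set1.
by rewrite set_itv_ge ?Rintegral_set0// -leNgt bnd_simp.
Qed.

Let coord_integrable f T i t : {in `]-oo, T[, continuous f} -> t < T ->
  lebesgue_measure.-integrable `[0, t] (EFin \o (fun s => f s ord0 i)).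
Proof.
move=> cf tT; apply: continuous_compact_integrable.
  exact: segment_compact.
apply: continuous_in_subspaceT => s; rewrite inE/= in_itv/= => /andP[_ st].
apply: (@continuous_comp _ _ _ f (fun u : 'rV[R]_n => u ord0 i)).
  by apply: cf; rewrite in_itv/= (le_lt_trans st).
exact: coord_continuous.
Qed.

Lemma is_derive_primitive f T t : {in `]-oo, T[, continuous f} ->
  0 < t < T -> is_derive t 1 (primitive f) (f t).
Proof.
move=> cf /andP[t0 tT]; apply/is_derive_rVP => i.
have [b tb bT] : exists2 b, t < b & b < T by exists ((t + T) / 2); lra.
have cfi : {for t, continuous (fun s => f s ord0 i)}.
  apply: (@continuous_comp _ _ _ f (fun u : 'rV[R]_n => u ord0 i)).
    by apply: cf; rewrite in_itv.
  exact: coord_continuous.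
have [dP P'] := continuous_FTC1_closed tb (coord_integrable i cf bT) t0 cfi.
rewrite (_ : (fun s => _) = parameterized_integral lebesgue_measure 0 ^~
  (fun s => f s ord0 i)); last by apply/funext => s; rewrite mxE.
by apply: DeriveDef; [exact: dP|rewrite -derive1E; exact: P'].
Qed.

Lemma continuous_primitive f T : {in `]-oo, T[, continuous f} ->
  {in `]-oo, T[, continuous (primitive f)}.
Proof.
move=> cf t; rewrite in_itv/= => tT; have [t0|t0|t0] := ltgtP t 0.
- apply: (@near_cst_continuous _ _ (0 : 'rV[R]_n)); near=> s.
  apply: primitive_le0.
  by near: s; exact: lt_le_nbhsl.
- by apply: is_derive_continuous (is_derive_primitive cf _); rewrite t0.
- rewrite {}t0 in tT *; rewrite /continuous_at primitive_le0//.
  have [b b0 bT] : exists2 b, 0 < b & b < T by exists (T / 2); lra.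
  apply/cvg_rVP => i; rewrite mxE; under eq_fun do rewrite mxE.
  exact: (parameterized_integral_cvg_left b0 (coord_integrable i cf bT)).
Unshelve. all: by end_near. Qed.

End primitive.

Section picard.
Context {R : realType} {n : nat}.
Implicit Types (u v : R -> 'rV[R]_n) (b c s t K : R).
Variables (T : R) (F : R -> 'rV[R]_n -> 'rV[R]_n) (y0 : 'rV[R]_n).
(* Negative times are included because the iterates, constant there, have to be
   continuous at 0 from both sides. *)
Hypothesis F_continuous : forall t (y : 'rV[R]_n),
  t < T -> {for (t, y), continuous (fun z : R * 'rV[R]_n => F z.1 z.2)}.
Hypothesis F_lipschitz : forall b, b < T ->
  exists2 K, 0 <= K &
    forall t y z, 0 <= t <= b -> `|F t y - F t z| <= K * `|y - z|.

Definition picard_step u t := y0 + primitive (fun s => F s (u s)) t.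

Definition picard_iter k := iter k picard_step (fun=> y0).

Definition picard_limit t := limn (picard_iter ^~ t).

Lemma picard_step_le0 u t : t <= 0 -> picard_step u t = y0.
Proof. by move=> t0; rewrite /picard_step primitive_le0 ?addr0. Qed.

Lemma picard_iter_le0 k t : t <= 0 -> picard_iter k t = y0.
Proof. by case: k => [//|k] t0; exact: picard_step_le0. Qed.

Let field_continuous u : {in `]-oo, T[, continuous u} ->
  {in `]-oo, T[, continuous (fun t => F t (u t))}.
Proof.
move=> cu t tT; apply: (@continuous_comp _ _ _ (fun s => (s, u s))
  (fun z : R * 'rV[R]_n => F z.1 z.2)).
  exact: (cvg_pair cvg_id (cu t tT)).
by apply: F_continuous; rewrite in_itv/= in tT.
Qed.

Lemma continuous_picard_step u : {in `]-oo, T[, continuous u} ->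
  {in `]-oo, T[, continuous (picard_step u)}.
Proof.
move=> cu t tT; apply: cvgD; first exact: cvg_cst.
exact: (continuous_primitive (field_continuous cu)).
Qed.

Lemma is_derive_picard_step u t : {in `]-oo, T[, continuous u} ->
  0 < t < T -> is_derive t 1 (picard_step u) (F t (u t)).
Proof.
move=> cu tT; rewrite -[X in is_derive _ _ _ X]add0r.
apply: (@is_deriveD _ _ _ (cst y0)).
exact: (is_derive_primitive (field_continuous cu)).
Qed.

Lemma continuous_picard_iter k : {in `]-oo, T[, continuous (picard_iter k)}.
Proof.
elim: k => [|k IH]; first by move=> t _; exact: cvg_cst.
exact: continuous_picard_step.
Qed.

Lemma picard_step_contract b c K u v : b < T -> 0 <= K -> 0 <= c ->
  (forall t y z, 0 <= t <= b -> `|F t y - F t z| <= K * `|y - z|) ->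
  {in `]-oo, T[, continuous u} -> {in `]-oo, T[, continuous v} ->
  (forall t, 0 <= t <= b -> `|u t - v t| <= c * expR (2 * K * t)) ->
  forall t, 0 <= t <= b ->
    `|picard_step u t - picard_step v t| <= c / 2 * expR (2 * K * t).
Proof.
move=> bT K0 c0 FK cu cv uv t /andP[t0 tb].
pose f := picard_step u - picard_step v; pose g s := c / 2 * expR (2 * K * s).
have inT s : s <= t -> s \in `]-oo, T[.
  by rewrite in_itv/= => /le_lt_trans; apply; exact: le_lt_trans bT.
have cf : {within `[0, t], continuous f}.
  apply: continuous_in_subspaceT => s; rewrite inE/= in_itv/= => /andP[_ st].
  by apply: continuousB; apply: continuous_picard_step => //; exact: inT.
have f' s : 0 < s < t -> is_derive s 1 f (F s (u s) - F s (v s)).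
  move=> /andP[s0 st]; have sT : 0 < s < T.
    by rewrite s0; have := inT s (ltW st); rewrite in_itv.
  by apply: is_deriveB; exact: is_derive_picard_step.
have g' s : is_derive s 1 g (K * (c * expR (2 * K * s))).
  apply: is_derive_eq (is_deriveZ (c / 2) (is_derive_expRM (2 * K) s)) _.
  by rewrite /GRing.scale/=; field.
have := ler_norm_is_derive t0 cf (is_derive_within (fun s _ => g' s)) f'
  (fun s _ => g' s).
rewrite /f !fctE !(picard_step_le0 _ (lexx 0)) subrr subr0 => fg.
apply: le_trans (fg _) _ => [s /andP[s0 st]|].
  have s0b : 0 <= s <= b by rewrite !ltW// (lt_le_trans st).
  by rewrite (le_trans (FK _ _ _ s0b))// ler_wpM2l// uv.
by rewrite gerBl mulr_ge0 ?expR_ge0// divr_ge0.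
Qed.

Lemma picard_iter_dist b : b < T -> exists c, forall k t, t <= b ->
  `|picard_iter k.+1 t - picard_iter k t| <= c / 2 ^+ k.
Proof.
move=> bT; have [K K0 FK] := F_lipschitz bT.
have [b0|b0] := leP 0 b; last first.
  exists 0 => k t /le_lt_trans/(_ b0)/ltW t0.
  by rewrite !picard_iter_le0// subrr normr0 mul0r.
have [c c0 first_step] : exists2 c, 0 <= c &
    forall t, 0 <= t <= b -> `|picard_iter 1 t - picard_iter 0 t| <= c.
  have [|s _ smax] := @EVT_max R (fun t => `|picard_iter 1 t - y0|) 0 b b0.
    apply: continuous_in_subspaceT => t; rewrite inE/= in_itv/= => /andP[_ tb].
    apply: cvg_norm; apply: cvgB; last exact: cvg_cst.
    by apply: (@continuous_picard_iter 1); rewrite in_itv/= (le_lt_trans tb).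
  by exists `|picard_iter 1 s - y0|.
have weighted k t : 0 <= t <= b ->
    `|picard_iter k.+1 t - picard_iter k t| <= c / 2 ^+ k * expR (2 * K * t).
  elim: k t => [|k IH] t tb.
    rewrite expr0 divr1 (le_trans (first_step t tb))// ler_peMr//.
    by have /andP[t0 _] := tb; rewrite -expR0 ler_expR !mulr_ge0.
  rewrite exprS [2 * _]mulrC invfM mulrA.
  apply: (picard_step_contract bT K0 _ FK _ _ IH) => //.
  - by rewrite divr_ge0 ?exprn_ge0.
  - exact: (@continuous_picard_iter k.+1).
  - exact: continuous_picard_iter.
exists (c * expR (2 * K * b)) => k t tb; have [t0|t0] := leP 0 t; last first.
  rewrite !picard_iter_le0 ?(ltW t0)// subrr normr0.
  by rewrite divr_ge0 ?mulr_ge0 ?expR_ge0 ?exprn_ge0.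
rewrite (le_trans (weighted k t _)) ?t0// mulrAC.
rewrite ler_wpM2r ?invr_ge0 ?exprn_ge0//.
by rewrite ler_wpM2l// ler_expR ler_wpM2l// mulr_ge0.
Qed.

Lemma picard_limit_dist b : b < T -> exists2 c, 0 <= c & forall k t, t <= b ->
  `|picard_iter k t - picard_limit t| <= c / 2 ^+ k.
Proof.
move=> /picard_iter_dist[c dist]; exists (2 * c) => [|k t tb].
  have := le_trans (normr_ge0 _) (dist 0 b (lexx b)).
  by rewrite expr0 divr1 => c0; rewrite mulr_ge0.
by apply: (geometric_dist_lim (u := picard_iter ^~ t)) => j; exact: dist.
Qed.

Lemma continuous_picard_limit : {in `]-oo, T[, continuous picard_limit}.
Proof.
move=> t tT; have [b tb bT] : exists2 b, t < b & b < T.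
  by move: tT; rewrite in_itv/= => tT; exists ((t + T) / 2); lra.
have [c _ dist] := picard_limit_dist bT.
apply: (continuous_geometric_limit (f_ := picard_iter) (c := c)) => [k|].
  exact: continuous_picard_iter.
by near=> s => k; apply: dist; near: s; exact: lt_le_nbhsl.
Unshelve. all: by end_near. Qed.

Lemma picard_limit_fixed t :
  t < T -> picard_step picard_limit t = picard_limit t.
Proof.
move=> tT; have [t0|/ltW t0] := leP t 0.
  rewrite picard_step_le0// /picard_limit.
  by under eq_fun do rewrite picard_iter_le0//; rewrite lim_cst.
have [K K0 FK] := F_lipschitz tT.
have [c c0 dist] := picard_limit_dist tT.
apply/eqP; rewrite -subr_eq0 -normr_le0.
pose w := expR (2 * K * t).
apply: (@le0_divr_exp2 _ _ (c / 2 * w + c / 2)) => k.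
apply: le_trans (ler_distD (picard_iter k.+1 t) _ _) _.
rewrite mulrDl lerD//; last first.
  by rewrite (le_trans (dist _ _ _))// exprS invfM mulrA.
rewrite distrC mulrAC [c / 2 / _]mulrAC.
apply: (picard_step_contract tT K0 _ FK _ continuous_picard_limit).
- by rewrite divr_ge0 ?exprn_ge0.
- exact: continuous_picard_iter.
- move=> s /andP[s0 st]; rewrite (le_trans (dist k s st))// ler_peMr//.
    by rewrite divr_ge0 ?exprn_ge0.
  by rewrite -expR0 ler_expR !mulr_ge0.
- by rewrite t0 lexx.
Qed.

Theorem picard_lindelof : exists y : R -> 'rV[R]_n,
  [/\ y 0 = y0, {in `]-oo, T[, continuous y} &
      forall t, 0 < t < T -> is_derive t 1 y (F t (y t))].
Proof.
exists (picard_step picard_limit); split.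
- exact: picard_step_le0.
- exact: continuous_picard_step continuous_picard_limit.
- move=> t tT; have [_ ltT] := andP tT; rewrite picard_limit_fixed//.
  exact: is_derive_picard_step continuous_picard_limit tT.
Qed.

End picard.

Section dotv_theory.
Context {R : realType} {d : nat}.
Implicit Types (u v w : 'rV[R]_d) (c : R).

Lemma dotvC u v : dotv u v = dotv v u.
Proof. by apply: eq_bigr => i _; rewrite mulrC. Qed.

Lemma dotvDl u v w : dotv (u + v) w = dotv u w + dotv v w.
Proof. by rewrite -big_split; apply: eq_bigr => i _; rewrite mxE mulrDl. Qed.

Lemma dotvZl c u v : dotv (c *: u) v = c * dotv u v.
Proof. by rewrite mulr_sumr; apply: eq_bigr => i _; rewrite mxE mulrA. Qed.

Lemma dotvNl u v : dotv (- u) v = - dotv u v.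
Proof. by rewrite -scaleN1r dotvZl mulN1r. Qed.

Lemma dotvDr u v w : dotv u (v + w) = dotv u v + dotv u w.
Proof. by rewrite dotvC dotvDl !(dotvC u). Qed.

Lemma dotvZr c u v : dotv u (c *: v) = c * dotv u v.
Proof. by rewrite dotvC dotvZl dotvC. Qed.

Lemma dotvNr u v : dotv u (- v) = - dotv u v.
Proof. by rewrite dotvC dotvNl dotvC. Qed.

Definition dotvE := (dotvDl, dotvDr, dotvNl, dotvNr, dotvZl, dotvZr).

Lemma dotv0 : dotv (0 : 'rV[R]_d) 0 = 0.
Proof. by rewrite -(scale0r 0) dotvZl mul0r. Qed.

Lemma dotv_ge0 u : 0 <= dotv u u.
Proof. by apply: sumr_ge0 => i _; rewrite -expr2 sqr_ge0. Qed.

Lemma sqr_norm_le_dotv u : `|u| ^+ 2 <= dotv u u.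
Proof.
suff : `|u| <= enorm u.
  by rewrite -ler_sqr ?nnegrE ?sqrtr_ge0// sqr_sqrtr ?dotv_ge0.
apply: ler_rV_norm => [|i]; first exact: sqrtr_ge0.
rewrite -sqrtr_sqr ler_wsqrtr// /dotv (bigD1 i)//= -expr2 lerDl.
by apply: sumr_ge0 => j _; rewrite -expr2 sqr_ge0.
Qed.

Lemma norm_le1D_dotv u : `|u| <= 1 + dotv u u.
Proof. by have := sqr_norm_le_dotv u; have := sqr_ge0 (`|u| - 1); nra. Qed.

Lemma norm_dotv_le u v : `|dotv u v| <= d%:R * (`|u| * `|v|).
Proof.
rewrite (le_trans (ler_norm_sum _ _ _))//.
rewrite -[X in _ <= X%:R * _]card_ord mulr_natl -sumr_const ler_sum// => i _.
by rewrite normrM ler_pM// ler_coord_norm.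
Qed.

Lemma dotv_le_sqr_norm u : dotv u u <= d%:R * `|u| ^+ 2.
Proof. by rewrite expr2 (le_trans (ler_norm _))// norm_dotv_le. Qed.

Lemma dotv_eq0 u : dotv u u <= 0 -> u = 0.
Proof.
move=> /(le_trans (sqr_norm_le_dotv u)) u0.
by apply/eqP; rewrite -normr_eq0 -sqrf_eq0 eq_le u0 sqr_ge0.
Qed.

Lemma enorm_sqr u : enorm u ^+ 2 = dotv u u.
Proof. by rewrite /enorm sqr_sqrtr ?dotv_ge0. Qed.

Lemma dotv_amgm u v : 2 * dotv u v <= dotv u u + dotv v v.
Proof. by have := dotv_ge0 (u - v); rewrite !dotvE (dotvC v u); lra. Qed.

Lemma dotv_amgmN u v : - (2 * dotv u v) <= dotv u u + dotv v v.
Proof. by have := dotv_amgm u (- v); rewrite !dotvE; lra. Qed.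

Lemma is_derive_dotv (u v : R -> 'rV[R]_d) (t : R) (du dv : 'rV[R]_d) :
  is_derive t 1 u du -> is_derive t 1 v dv ->
  is_derive t 1 (fun s => dotv (u s) (v s)) (dotv du (v t) + dotv (u t) dv).
Proof.
move=> /is_derive_rVP u' /is_derive_rVP v'.
have := @is_derive_sum _ _ _ d
  (fun i => (fun s => u s ord0 i) * (fun s => v s ord0 i)) t 1 _
  (fun i => is_deriveM (u' i) (v' i)).
rewrite fct_sumE => uv'; apply: (is_derive_eq uv').
rewrite /dotv -big_split/=; apply: eq_bigr => i _.
by rewrite addrC [du _ _ * _]mulrC.
Qed.

Lemma is_derive_sqr_dotv (u : R -> 'rV[R]_d) (t : R) (du : 'rV[R]_d) :
  is_derive t 1 u du ->
  is_derive t 1 (fun s => dotv (u s) (u s)) (2 * dotv (u t) du).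
Proof.
move=> u'; apply: is_derive_eq (is_derive_dotv u' u') _.
by rewrite dotvC mulr_natl mulr2n.
Qed.

Lemma cvg_dotv {T : Type} (F : set_system T) {FF : Filter F}
    (u v : T -> 'rV[R]_d) (l m : 'rV[R]_d) :
  u x @[x --> F] --> l -> v x @[x --> F] --> m ->
  dotv (u x) (v x) @[x --> F] --> dotv l m.
Proof.
move=> /cvg_rVP ul /cvg_rVP vm; rewrite /dotv.
by apply: cvg_big => [|i _]; [exact: add_continuous|exact: cvgM].
Qed.

End dotv_theory.

Section lipschitz_operators.
Context {R : realType} {d : nat} (A : 'rV[R]_d -> 'rV[R]_d).
Hypothesis AL : lipschitz_op A.

Lemma lipschitz_op_dotv : exists2 L : R, 0 <= L & forall x y,
  dotv (A x - A y) (A x - A y) <= L * dotv (x - y) (x - y).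
Proof.
have [L LA] := AL; exists (L ^+ 2) => [|x y]; first exact: sqr_ge0.
rewrite -!enorm_sqr -exprMn ler_sqr ?nnegrE ?sqrtr_ge0//.
exact: le_trans (sqrtr_ge0 _) (LA x y).
Qed.

Lemma lipschitz_op_norm : exists2 K : R, 0 <= K & forall x y,
  `|A x - A y| <= K * `|x - y|.
Proof.
have [L L0 LA] := lipschitz_op_dotv.
have Ld : 0 <= L * d%:R by rewrite mulr_ge0.
exists (Num.sqrt (L * d%:R)) => [|x y]; first exact: sqrtr_ge0.
rewrite -ler_sqr ?nnegrE ?mulr_ge0 ?sqrtr_ge0// exprMn sqr_sqrtr//.
rewrite (le_trans (sqr_norm_le_dotv _))// (le_trans (LA x y))// -mulrA.
by rewrite ler_wpM2l// dotv_le_sqr_norm.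
Qed.

Lemma cvg_lipschitz_op {T : Type} (F : set_system T) {FF : Filter F}
    (u : T -> 'rV[R]_d) (l : 'rV[R]_d) :
  u x @[x --> F] --> l -> A (u x) @[x --> F] --> A l.
Proof.
have [K K0 KA] := lipschitz_op_norm.
by apply: continuous_cvg; exact: lipschitz_continuous K0 KA l.
Qed.

End lipschitz_operators.

(* The drift [A X] is replaced by a free input [a], which makes flows closed
   under differences. *)
Definition anchor_flow (R : realType) (d : nat) (T : R)
    (x z a : R -> 'rV[R]_d) : Prop :=
  [/\ x t @[t --> 0^'+] --> x 0, z t @[t --> 0^'+] --> z 0 &
      forall t : R, 0 < t < T -> is_derive t 1 x (- (z t + a t)) /\
        is_derive t 1 z (- ((T - t)^-1 *: (z t + a t)))].

Section anchor_flow_theory.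
Context {R : realType} {d : nat} (T : R).
Implicit Types (x z a : R -> 'rV[R]_d) (A : 'rV[R]_d -> 'rV[R]_d).

Lemma anchor_flow_cst (p a : 'rV[R]_d) :
  anchor_flow T (cst p) (cst (- a)) (cst a).
Proof.
split; [exact: cvg_cst|exact: cvg_cst|move=> t _].
by rewrite /= addNr scaler0 oppr0; split; exact: is_derive_cst.
Qed.

Lemma anchor_flowB x1 z1 a1 x2 z2 a2 :
  anchor_flow T x1 z1 a1 -> anchor_flow T x2 z2 a2 ->
  anchor_flow T (x1 - x2) (z1 - z2) (a1 - a2).
Proof.
move=> [cx1 cz1 flow1] [cx2 cz2 flow2]; split; [exact: cvgB|exact: cvgB|].
move=> t tT; have [x1' z1'] := flow1 t tT; have [x2' z2'] := flow2 t tT.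
have -> : (z1 - z2) t + (a1 - a2) t = z1 t + a1 t - (z2 t + a2 t).
  by rewrite !fctE opprD addrACA.
rewrite scalerBr !opprB; split.
- by apply: is_derive_eq (is_deriveB x1' x2') _; rewrite opprK addrC.
- by apply: is_derive_eq (is_deriveB z1' z2') _; rewrite opprK addrC.
Qed.

Lemma dual_anchor_solP A (x0 : 'rV[R]_d) x z :
  dual_anchor_sol A T x0 x z <->
  [/\ x 0 = x0, z 0 = 0 & anchor_flow T x z (A \o x)].
Proof.
split=> [[xx0 zz0 cx cz sol]|[xx0 zz0 [cx cz flow]]].
  split; [exact: xx0|exact: zz0|split; [by rewrite xx0|by rewrite zz0|]].
  move=> t tT; have [dx dz x' z'] := sol t tT; split; apply: DeriveDef.
  - exact: dx.
  - by rewrite -derive1E x' opprD.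
  - exact: dz.
  - by rewrite -derive1E z' scalerDr opprD.
split; [exact: xx0|exact: zz0|by rewrite -xx0|by rewrite -zz0|].
move=> t tT; have [[dx x'] [dz z']] := flow t tT.
split; [exact: dx|exact: dz|by rewrite derive1E x' opprD|].
by rewrite derive1E z' scalerDr opprD.
Qed.

End anchor_flow_theory.

Section anchor_flow_existence.
Context {R : realType} {d : nat} (A : 'rV[R]_d -> 'rV[R]_d) (T : R).
Hypothesis AL : lipschitz_op A.

Definition anchor_field (t : R) (y : 'rV[R]_(d + d)) : 'rV[R]_(d + d) :=
  let w := rsubmx y + A (lsubmx y) in row_mx (- w) (- ((T - t)^-1 *: w)).

Lemma continuous_anchor_field (t : R) (y : 'rV[R]_(d + d)) : t < T ->
  {for (t, y), continuous (fun r : R * 'rV[R]_(d + d) => anchor_field r.1 r.2)}.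
Proof.
move=> tT; have ct : r.1 @[r --> (t, y)] --> t by exact: cvg_fst.
have cy : r.2 @[r --> (t, y)] --> y by exact: cvg_snd.
have cw : rsubmx r.2 + A (lsubmx r.2) @[r --> (t, y)] -->
    rsubmx y + A (lsubmx y).
  rewrite lsubmxEsub rsubmxEsub; apply: cvgD; first exact: cvg_colsub.
  by apply: cvg_lipschitz_op => //; exact: cvg_colsub.
have c_inv : (T - r.1)^-1 @[r --> (t, y)] --> (T - t)^-1.
  exact: (continuous_cvg _ (is_derive_continuous (is_derive_subV tT)) ct).
apply: cvg_row_mx; first exact: cvgN.
by apply: cvgN; exact: cvgZ.
Qed.

Lemma anchor_field_lipschitz (b : R) : b < T -> exists2 K : R,
  0 <= K & forall (t : R) y1 y2, 0 <= t <= b ->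
    `|anchor_field t y1 - anchor_field t y2| <= K * `|y1 - y2|.
Proof.
move=> bT; have [K K0 AK] := lipschitz_op_norm AL.
have Tb : 0 < T - b by rewrite subr_gt0.
exists ((1 + (T - b)^-1) * (1 + K)) => [|t y1 y2 /andP[_ tb]].
  by rewrite mulr_ge0 ?addr_ge0 ?invr_ge0// ltW.
have Tt : 0 < T - t by rewrite subr_gt0 (le_lt_trans tb).
pose w y := rsubmx y + A (lsubmx y).
have w_dist : `|w y1 - w y2| <= (1 + K) * `|y1 - y2|.
  rewrite /w opprD addrACA (le_trans (ler_normD _ _))// mulrDl mul1r lerD//.
    by rewrite -linearB/= rsubmxEsub norm_colsub_le.
  rewrite (le_trans (AK _ _))// ler_wpM2l//.
  by rewrite -linearB/= lsubmxEsub norm_colsub_le.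
rewrite /anchor_field opp_row_mx add_row_mx -!opprD.
apply: norm_row_mx_le; rewrite normrN -/(w y1) -/(w y2) -mulrA.
  rewrite (le_trans w_dist)// ler_peMl ?mulr_ge0 ?addr_ge0//.
  by rewrite lerDl invr_ge0 ltW.
rewrite -scalerBr normrZ gtr0_norm ?invr_gt0// ler_pM ?invr_ge0 ?(ltW Tt)//.
by rewrite (@le_trans _ _ (T - b)^-1) ?lerDr// lef_pV2 ?posrE// lerB.
Qed.

Lemma anchor_flow_exists (x0 z0 : 'rV[R]_d) : 0 < T ->
  exists x z, [/\ x 0 = x0, z 0 = z0 & anchor_flow T x z (A \o x)].
Proof.
move=> T0; have [y [y0 cy y']] := picard_lindelof (row_mx x0 z0)
  continuous_anchor_field anchor_field_lipschitz.
have cy0 : y t @[t --> 0^'+] --> y 0.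
  by apply: cvg_at_right_filter; apply: cy; rewrite in_itv.
exists (lsubmx \o y), (rsubmx \o y); split=> /=.
- by rewrite y0 row_mxKl.
- by rewrite y0 row_mxKr.
rewrite lsubmxEsub rsubmxEsub; split; [exact: cvg_colsub|exact: cvg_colsub|].
move=> t /y' yt; rewrite -lsubmxEsub -rsubmxEsub.
have := is_derive_colsub (lshift d) yt.
have := is_derive_colsub (@rshift d d) yt.
by rewrite -lsubmxEsub -rsubmxEsub row_mxKl row_mxKr.
Qed.

End anchor_flow_existence.

Definition anchor_energy (R : realType) (d : nat) (T : R)
    (x z : R -> 'rV[R]_d) (t : R) : R :=
  dotv (x t) (x t) + (T - t) * dotv (z t) (z t).

Definition anchor_potential (R : realType) (d : nat) (T : R)
    (x z : R -> 'rV[R]_d) (t : R) : R :=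
  (T - t)^-1 * dotv (z t) (x t) - dotv (z t) (z t) / 2.

Section anchor_flow_estimates.
Context {R : realType} {d : nat} (T : R) (x z a : R -> 'rV[R]_d).
Hypothesis T0 : 0 < T.
Hypothesis flow : anchor_flow T x z a.
Implicit Types s t c : R.

Let cvg_x : x t @[t --> 0^'+] --> x 0. Proof. by case: flow. Qed.

Let cvg_z : z t @[t --> 0^'+] --> z 0. Proof. by case: flow. Qed.

Let is_derive_x t (tT : 0 < t < T) : is_derive t 1 x (- (z t + a t)).
Proof. by case: flow => _ _ /(_ t tT)[]. Qed.

Let is_derive_z t (tT : 0 < t < T) :
  is_derive t 1 z (- ((T - t)^-1 *: (z t + a t))).
Proof. by case: flow => _ _ /(_ t tT)[]. Qed.

Let cvg_inv : (T - t)^-1 @[t --> 0^'+] --> (T - 0)^-1.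
Proof.
by apply: cvg_at_right_filter; exact: is_derive_continuous (is_derive_subV T0).
Qed.

Lemma anchor_energy_le c : 0 <= c ->
  (forall t, 0 < t < T -> dotv (a t) (a t) <= c * dotv (x t) (x t)) ->
  forall t, 0 <= t < T ->
    anchor_energy T x z t <= anchor_energy T x z 0 * expR ((2 + 2 * c) * t).
Proof.
move=> c0 ac t tT; rewrite -[X in expR (_ * X)]subr0.
pose rate t := 2 * dotv (x t) (- (z t + a t)) + (- dotv (z t) (z t) +
  (T - t) * (2 * dotv (z t) (- ((T - t)^-1 *: (z t + a t))))).
have is_derive_subT s : is_derive s 1 (fun t => T - t) (-1).
  apply: is_derive_eq (is_deriveB (is_derive_cst T s 1) (is_derive_id s 1)) _.
  by rewrite sub0r.
apply: (gronwall_le (df := rate) _ _ _ tT) => [|s sT|s sT].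
- apply: cvgD; first exact: cvg_dotv cvg_x cvg_x.
  apply: cvgM; last exact: cvg_dotv cvg_z cvg_z.
  by apply: cvg_at_right_filter; exact: is_derive_continuous (is_derive_subT 0).
- apply: is_derive_eq (is_deriveD (is_derive_sqr_dotv (is_derive_x sT))
    (is_deriveM (is_derive_subT s) (is_derive_sqr_dotv (is_derive_z sT)))) _.
  by rewrite /rate /GRing.scale/=; ring.
(* The weight T - s cancels the singular factor of the derivative of z, and the
   damping - 3 |z|^2 absorbs the cross terms. *)
have /andP[_ ltT] := sT; have Ts : T - s != 0 by rewrite lt0r_neq0// subr_gt0.
have -> : rate s = - 2 * dotv (x s) (z s) - 2 * dotv (x s) (a s) -
    3 * dotv (z s) (z s) - 2 * dotv (z s) (a s).
  by rewrite /rate !dotvE; field.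
have := ac s sT; have := dotv_ge0 (x s); have := dotv_ge0 (z s).
have := dotv_amgmN (x s) (z s); have := dotv_amgmN (x s) (a s).
have := dotv_amgmN (z s) (a s); rewrite /anchor_energy.
have : 0 <= (2 + 2 * c) * ((T - s) * dotv (z s) (z s)).
  by rewrite mulr_ge0 ?addr_ge0 ?mulr_ge0 ?dotv_ge0 ?subr_ge0 ?(ltW ltT).
lra.
Qed.

Lemma anchor_dual_le (g dg : R -> R) :
  g t @[t --> 0^'+] --> g 0 ->
  (forall t, 0 < t < T -> is_derive t 1 g (dg t)) ->
  (forall t, 0 < t < T -> (T - t)^-1 ^+ 2 * dotv (a t) (a t) <= dg t) ->
  forall t, 0 <= t < T ->
    (T - t)^-1 * dotv (z t) (z t) - g t <= T^-1 * dotv (z 0) (z 0) - g 0.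
Proof.
move=> g0 g' ag t tT; rewrite -[X in X^-1 * dotv (z 0) _]subr0.
pose f t := (T - t)^-1 * dotv (z t) (z t) - g t.
pose df t := (T - t)^-1 * (2 * dotv (z t) (- ((T - t)^-1 *: (z t + a t)))) +
  dotv (z t) (z t) * (T - t)^-1 ^+ 2 - dg t.
apply: (@ler0_is_derive_le _ f df 0 T _ _ _ t tT) => [|s sT|s sT].
- by apply: cvgB g0; apply: cvgM; [exact: cvg_inv|exact: cvg_dotv cvg_z cvg_z].
- have /andP[_ ltT] := sT.
  exact: (is_deriveB (is_deriveM (is_derive_subV ltT)
    (is_derive_sqr_dotv (is_derive_z sT))) (g' s sT)).
rewrite /df subr_le0 (le_trans _ (ag s sT))//.
have := ler_wpM2l (sqr_ge0 (T - s)^-1) (dotv_amgmN (z s) (a s)).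
by rewrite !dotvE; lra.
Qed.

Lemma anchor_dual_bounded c : 0 <= c ->
  (forall t, 0 < t < T -> dotv (a t) (a t) <= c) ->
  forall t, 0 <= t < T -> dotv (z t) (z t) <= dotv (z 0) (z 0) + c.
Proof.
move=> c0 ac t tT; have /andP[t0 ltT] := tT.
have g0 : c * (T - s)^-1 @[s --> 0^'+] --> c * (T - 0)^-1.
  by apply: cvgM; [exact: cvg_cst|exact: cvg_inv].
have zc : dotv (z t) (z t) - c <= (T - t) / T * (dotv (z 0) (z 0) - c).
  rewrite -mulrA -ler_pdivrMl ?subr_gt0// mulrBr mulrBr ![_ * c]mulrC.
  have := @anchor_dual_le _ (fun s => c * (T - s)^-1 ^+ 2) g0 _ _ t tT.
  rewrite subr0; apply=> s sT.
    by have /andP[_ ltsT] := sT; exact: is_deriveZ (is_derive_subV ltsT).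
  by rewrite mulrC ler_wpM2r ?sqr_ge0// ac.
have Tt : 0 <= (T - t) / T <= 1.
  rewrite divr_ge0 ?subr_ge0 ?(ltW ltT) ?(ltW T0)//=.
  by rewrite ler_pdivrMr// mul1r gerBl.
have := dotv_ge0 (z 0); move: zc Tt.
nra.
Qed.

Lemma anchor_dual_decay c : 0 <= c ->
  (forall t, 0 < t < T -> dotv (a t) (a t) <= c * (T - t) ^+ 2) ->
  forall t, 0 <= t < T ->
    dotv (z t) (z t) <= (T^-1 * dotv (z 0) (z 0) + c * T) * (T - t).
Proof.
move=> c0 ac t tT; have /andP[t0 ltT] := tT.
have g0 : c * s @[s --> 0^'+] --> c * 0.
  by apply: cvg_at_right_filter; apply: cvgM; [exact: cvg_cst|exact: cvg_id].
rewrite -ler_pdivrMr ?subr_gt0// mulrC.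
apply: (@le_trans _ _ (T^-1 * dotv (z 0) (z 0) + c * t)); last first.
  by rewrite lerD2l ler_wpM2l// ltW.
have := @anchor_dual_le _ (cst c) g0 _ _ t tT.
rewrite mulr0 subr0 lerBlDr; apply=> s sT; first exact: is_derive_mull.
have /andP[_ ltsT] := sT.
by rewrite exprVn ler_pdivrMl ?exprn_gt0 ?subr_gt0// mulrC ac.
Qed.

Lemma anchor_potential_le : (forall t, 0 < t < T -> 0 <= dotv (a t) (x t)) ->
  forall t, 0 <= t < T -> anchor_potential T x z t <= anchor_potential T x z 0.
Proof.
move=> ax; pose rate t := - ((T - t)^-1 ^+ 2 * dotv (a t) (x t)).
apply: (ler0_is_derive_le (df := rate)) => [|t tT|t tT].
- apply: cvgB; apply: cvgM.
  + exact: cvg_inv.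
  + exact: cvg_dotv cvg_z cvg_x.
  + exact: cvg_dotv cvg_z cvg_z.
  + exact: cvg_cst.
- have /andP[_ ltT] := tT.
  have -> : anchor_potential T x z = (fun t => (T - t)^-1) *
      (fun t => dotv (z t) (x t)) - 2^-1 \*: (fun t => dotv (z t) (z t)).
    by apply/funext => s; rewrite /anchor_potential [_ / 2]mulrC.
  apply: is_derive_eq (is_deriveB (is_deriveM (is_derive_subV ltT)
    (is_derive_dotv (is_derive_z tT) (is_derive_x tT)))
    (is_deriveZ 2^-1 (is_derive_sqr_dotv (is_derive_z tT)))) _.
  by rewrite /rate /GRing.scale/= !dotvE; field; rewrite lt0r_neq0// subr_gt0.
- by rewrite oppr_le0 mulr_ge0 ?sqr_ge0 ?ax.
Qed.

End anchor_flow_estimates.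

Section anchor_flow_lipschitz.
Context {R : realType} {d : nat} (A : 'rV[R]_d -> 'rV[R]_d) (T : R).
Hypotheses (AL : lipschitz_op A) (T0 : 0 < T).
Implicit Types (x z : R -> 'rV[R]_d) (t c : R).

Lemma anchor_flow_stable x1 z1 x2 z2 :
  anchor_flow T x1 z1 (A \o x1) -> anchor_flow T x2 z2 (A \o x2) ->
  exists c, forall t, 0 <= t < T -> anchor_energy T (x1 - x2) (z1 - z2) t <=
    anchor_energy T (x1 - x2) (z1 - z2) 0 * expR (c * t).
Proof.
move=> flow1 flow2; have [L L0 LA] := lipschitz_op_dotv AL.
exists (2 + 2 * L) => t.
apply: (anchor_energy_le (anchor_flowB flow1 flow2) L0) => s _.
exact: LA.
Qed.

Lemma anchor_flow_unique x1 z1 x2 z2 :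
  anchor_flow T x1 z1 (A \o x1) -> anchor_flow T x2 z2 (A \o x2) ->
  x1 0 = x2 0 -> z1 0 = z2 0 ->
  forall t, 0 <= t < T -> x1 t = x2 t /\ z1 t = z2 t.
Proof.
move=> flow1 flow2 x120 z120 t tT; have /andP[_ ltT] := tT.
have [c /(_ t tT)] := anchor_flow_stable flow1 flow2.
have -> : anchor_energy T (x1 - x2) (z1 - z2) 0 = 0.
  by rewrite /anchor_energy !fctE x120 z120 !subrr dotv0 mulr0 addr0.
rewrite mul0r /anchor_energy !fctE => e0.
have x_ge0 := dotv_ge0 (x1 t - x2 t).
have z_ge0 : 0 <= (T - t) * dotv (z1 t - z2 t) (z1 t - z2 t).
  by rewrite mulr_ge0 ?dotv_ge0// subr_ge0 ltW.
split; apply/eqP; rewrite -subr_eq0; apply/eqP/dotv_eq0; first by lra.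
by rewrite -(pmulr_rle0 _ (_ : 0 < T - t)) ?subr_gt0//; lra.
Qed.

Section limit.
Variables (x z : R -> 'rV[R]_d).
Hypothesis flow : anchor_flow T x z (A \o x).

Let deviation (p : 'rV[R]_d) :
  anchor_flow T (x - cst p) (z - cst (- A p)) (A \o x - cst (A p)) :=
  anchor_flowB flow (anchor_flow_cst T p (A p)).

Lemma anchor_state_bounded (p : 'rV[R]_d) : exists2 c, 0 <= c &
  forall t, 0 <= t < T -> dotv (x t - p) (x t - p) <= c.
Proof.
have [c e_le] := anchor_flow_stable flow (anchor_flow_cst T p (A p)).
set e := anchor_energy T (x - cst p) (z - cst (- A p)) in e_le.
have dotv_le_e t : t <= T -> dotv (x t - p) (x t - p) <= e t.
  by move=> tT; rewrite lerDl mulr_ge0 ?dotv_ge0// subr_ge0.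
have e0 : 0 <= e 0 by exact: le_trans (dotv_ge0 _) (dotv_le_e 0 (ltW T0)).
exists (e 0 * expR (`|c| * T)) => [|t tT]; first by rewrite mulr_ge0 ?expR_ge0.
have /andP[t0 /ltW leT] := tT.
rewrite (le_trans (dotv_le_e t leT))// (le_trans (e_le t tT))//.
rewrite ler_wpM2l// ler_expR (le_trans (ler_norm _))//.
by rewrite normrM (ger0_norm t0) ler_wpM2l.
Qed.

Lemma anchor_velocity_bounded :
  exists c, forall t, 0 < t < T -> `|z t + A (x t)| <= c.
Proof.
have [L L0 LA] := lipschitz_op_dotv AL.
have [c c0 xc] := anchor_state_bounded 0.
have Ac t : 0 <= t < T -> dotv (A (x t) - A 0) (A (x t) - A 0) <= L * c.
  by move=> tT; rewrite (le_trans (LA _ _))// ler_wpM2l// xc.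
have zc t : 0 <= t < T ->
    dotv (z t + A 0) (z t + A 0) <= dotv (z 0 + A 0) (z 0 + A 0) + L * c.
  move=> tT; have := anchor_dual_bounded T0 (deviation 0) (mulr_ge0 L0 c0).
  rewrite !fctE !opprK => /(_ _ t tT); apply=> s /andP[s0 sT].
  by apply: Ac; rewrite ltW.
exists (1 + (dotv (z 0 + A 0) (z 0 + A 0) + L * c) + (1 + L * c)) => t.
move=> /andP[/ltW t0 tT]; have {t0}tT : 0 <= t < T by rewrite t0.
have -> : z t + A (x t) = (z t + A 0) + (A (x t) - A 0).
  by rewrite [z t + A 0]addrC [RHS]addrC subrKA addrC.
rewrite (le_trans (ler_normD _ _))// lerD//.
  by rewrite (le_trans (norm_le1D_dotv _))// lerD2l zc.
by rewrite (le_trans (norm_le1D_dotv _))// lerD2l Ac.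
Qed.

Lemma anchor_state_cvg : exists2 xT, x t @[t --> T^'-] --> xT &
  exists c, forall t, 0 < t < T -> `|x t - xT| <= c * (T - t).
Proof.
have [c xc] := anchor_velocity_bounded; have [_ _ flow'] := flow.
have x' t : 0 < t < T -> is_derive t 1 x (- (z t + A (x t))).
  by move=> /flow'[].
have [t /xc|xT xxT x_dist] := cvg_at_left_bounded_derive (c := c) T0 x'.
  by rewrite normrN.
by exists xT => //; exists c.
Qed.

Variables (xT : 'rV[R]_d) (c : R).
Hypothesis x_dist : forall t, 0 < t < T -> `|x t - xT| <= c * (T - t).

Lemma anchor_dual_cvg : z t @[t --> T^'-] --> - A xT.
Proof.
have [L L0 LA] := lipschitz_op_dotv AL; pose k := L * (d%:R * c ^+ 2).
have k0 : 0 <= k by exact: mulr_ge0 L0 (mulr_ge0 (ler0n _ _) (sqr_ge0 _)).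
have Ak t : 0 < t < T ->
    dotv (A (x t) - A xT) (A (x t) - A xT) <= k * (T - t) ^+ 2.
  move=> tT; have -> : k * (T - t) ^+ 2 = L * (d%:R * (c * (T - t)) ^+ 2).
    by rewrite /k; ring.
  rewrite (le_trans (LA _ _))// ler_wpM2l// (le_trans (dotv_le_sqr_norm _))//.
  rewrite ler_wpM2l// lerXn2r ?nnegrE ?x_dist//.
  exact: le_trans (normr_ge0 _) (x_dist tT).
have decay := anchor_dual_decay T0 (deviation xT) k0 Ak.
apply/cvgrPdist_lt => e e0; near=> t; rewrite distrC.
have t0 : 0 < t by near: t; exact: nbhs_left_gt.
have tT : t < T by near: t; exact: nbhs_left_lt.
rewrite -ltr_sqr ?nnegrE ?(ltW e0)// (le_lt_trans (sqr_norm_le_dotv _))//.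
rewrite (le_lt_trans (decay t _)) ?(ltW t0)//.
by near: t; apply: near_left_mulB_lt; rewrite exprn_gt0.
Unshelve. all: by end_near. Qed.

Lemma anchor_initial_potential_ge0 : monotone_op A ->
  0 <= T^-1 * dotv (z 0 + A xT) (x 0 - xT) - dotv (z 0 + A xT) (z 0 + A xT) / 2.
Proof.
move=> AM; pose u t := z t + A xT.
have := anchor_potential_le T0 (deviation xT) (fun t _ => AM (x t) xT).
rewrite /anchor_potential !fctE !opprK subr0 => potential_le.
have cu : - (d%:R * (`|u t| * c)) - dotv (u t) (u t) / 2 @[t --> T^'-] --> 0.
  have -> : (0 : R) =
      - (d%:R * (`|0 : 'rV[R]_d| * c)) - dotv (0 : 'rV[R]_d) 0 / 2.
    by rewrite normr0 dotv0 !mul0r mulr0 !oppr0 addr0.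
  have u0 : u t @[t --> T^'-] --> (0 : 'rV[R]_d).
    by rewrite -(addNr (A xT)); exact: cvgD anchor_dual_cvg (cvg_cst _).
  apply: cvgB.
    apply: cvgN; apply: cvgM; first exact: cvg_cst.
    by apply: cvgM; [exact: cvg_norm|exact: cvg_cst].
  by apply: cvgM; [exact: cvg_dotv|exact: cvg_cst].
apply: (cvgr_to_le cu); near=> t.
have t0 : 0 < t by near: t; exact: nbhs_left_gt.
have tT : t < T by near: t; exact: nbhs_left_lt.
apply: le_trans (potential_le t _); last by rewrite (ltW t0).
rewrite lerD2r lerNl -mulrN ler_pdivrMl ?subr_gt0//.
apply: le_trans (ler_norm _) _; rewrite normrN.
apply: le_trans (norm_dotv_le _ _) _; rewrite [leRHS]mulrCA ler_wpM2l//.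
by rewrite [leRHS]mulrCA ler_wpM2l// [leRHS]mulrC x_dist// t0.
Unshelve. all: by end_near. Qed.

End limit.
End anchor_flow_lipschitz.

Lemma monotone_residual_le (R : realType) (d : nat) (A : 'rV[R]_d -> 'rV[R]_d)
    (T : R) (x0 xT xs : 'rV[R]_d) : monotone_op A -> 0 < T ->
  0 <= T^-1 * dotv (A xT) (x0 - xT) - dotv (A xT) (A xT) / 2 -> A xs = 0 ->
  enorm (A xT) ^+ 2 <= 4 * enorm (x0 - xs) ^+ 2 / T ^+ 2.
Proof.
move=> AM T0 potential_ge0 Axs; rewrite !enorm_sqr.
have mono : 0 <= T^-1 * dotv (A xT) (xT - xs).
  rewrite mulr_ge0 ?invr_ge0 ?(ltW T0)//.
  by have := AM xT xs; rewrite Axs subr0.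
pose v := (2 / T) *: (x0 - xs).
have <- : dotv v v = 4 * dotv (x0 - xs) (x0 - xs) / T ^+ 2.
  by rewrite dotvZl dotvZr; field; rewrite lt0r_neq0.
have Av : 2 * dotv (A xT) v =
    4 * (T^-1 * dotv (A xT) (x0 - xT)) + 4 * (T^-1 * dotv (A xT) (xT - xs)).
  by rewrite dotvZr -[x0 - xs](subrKA xT) (dotvDr _ (x0 - xT)); ring.
have := dotv_amgm (A xT) v.
lra.
Qed.

Unset Implicit Arguments.

Theorem theorem7p1 (R : realType) (d : nat) (A : 'rV[R]_d -> 'rV[R]_d)
  (T : R) (X0 : 'rV[R]_d) :
  lipschitz_op A -> monotone_op A -> 0 < T ->
  exists X Z : R -> 'rV[R]_d,
    [/\ dual_anchor_sol A T X0 X Z,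
        (forall X' Z' : R -> 'rV[R]_d, dual_anchor_sol A T X0 X' Z' ->
           forall t : R, 0 <= t < T -> X' t = X t /\ Z' t = Z t) &
        exists XT : 'rV[R]_d,
          X t @[t --> T^'-] --> XT /\
          forall Xs : 'rV[R]_d, A Xs = 0 ->
            enorm (A XT) ^+ 2 <= 4 * enorm (X0 - Xs) ^+ 2 / T ^+ 2].
Proof.
move=> AL AM T0.
have [X [Z [XX0 Z0 flow]]] := anchor_flow_exists AL X0 0 T0.
exists X, Z; split; first exact/dual_anchor_solP.
  move=> X' Z' /dual_anchor_solP[X'X0 Z'0 flow'].
  by apply: (anchor_flow_unique AL flow' flow); rewrite ?XX0 ?Z0.
have [XT XXT [c X_dist]] := anchor_state_cvg AL T0 flow.
exists XT; split=> // Xs; apply: monotone_residual_le => //.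
have := anchor_initial_potential_ge0 AL T0 flow X_dist AM.
by rewrite XX0 Z0 add0r.
Qed.
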